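(* Let $G$ and $H$ be \'etale, ample groupoids with $\sigma$-compact unit spaces. If $G$ and $H$ are groupoid equivalent, then $S(G)\cong S(H)$ (as abelian monoids).
   Context: All topological groupoids are assumed locally compact, second countable and Hausdorff. $G^{(0)}$ is the unit space, $r,s:G\to G^{(0)}$ the range and source maps. $G$ is \'etale if $r,s$ are local homeomorphisms. An open bisection is an open set $E\subseteq G$ such that $r(E),s(E)$ are open and $r|_E$, $s|_E$ are homeomorphisms onto them. $G$ is ample if its topology has a basis of compact open bisections. Groupoid equivalence is the standard notion of Muhly--Renault--Williams: there is a locally compact Hausdorff space $Z$ carrying commuting free and proper left $G$- and right $H$-actions whose anchor maps $Z\to G^{(0)}$ and $Z\to H^{(0)}$ are open surjections inducing homeomorphisms $Z/H\cong G^{(0)}$ and $G\backslash Z\cong H^{(0)}$. Type semigroup: let $C_c(G^{(0)},\mathbb{Z})^+$ be the non-negative compactly supported continuous integer-valued functions on $G^{(0)}$, and $\mathbf{1}_A$ the characteristic function of $A$. Write $f\sim_G g$ if there are compact open bisections $E_1,\dots,E_n$ of $G$ with $f=\sum_{i=1}^n\mathbf{1}_{s(E_i)}$ and $g=\sum_{i=1}^n\mathbf{1}_{r(E_i)}$; this is an equivalence relation. $S(G):=C_c(G^{(0)},\mathbb{Z})^+/\!\sim_G$, with classes $[f]_G$ and addition $[f]_G+[g]_G=[f+g]_G$. *)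

(* Defs.v *)
From HB Require Import structures.
From mathcomp Require Import all_boot all_order all_algebra.
From mathcomp Require Import all_classical.
From mathcomp Require Import topology numfun.

Set Implicit Arguments.
Unset Strict Implicit.
Unset Printing Implicit Defensive.

Import Order.TTheory GRing.Theory Num.Theory.

Local Open Scope classical_set_scope.
Local Open Scope ring_scope.
Local Open Scope quotient_scope.

Definition open_map (X Y : topologicalType) (f : X -> Y) :=
  forall U : set X, open U -> open (f @` U).

Definition homeomorphism (X Y : topologicalType) (f : X -> Y) :=
  continuous f /\ exists g : Y -> X, [/\ continuous g, cancel f g & cancel g f].

(* The restriction of f to A is a homeomorphism onto f(A). *)
Definition homeo_on (X Y : topologicalType) (f : X -> Y) (A : set X) :=
  {within A, continuous f} /\
  exists g : Y -> X, {within f @` A, continuous g} /\ {in A, cancel f g}.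

Definition local_homeomorphism (X Y : topologicalType) (f : X -> Y) :=
  forall x, exists U : set X, [/\ open U, U x, open (f @` U) & homeo_on f U].

Definition sigma_compact (X : topologicalType) :=
  exists K : nat -> set X,
    (forall n, compact (K n)) /\ \bigcup_n K n = [set: X].

(* The unit space is a separate type, identified with its image under gunit;
   gunit is a topological embedding because gsource is a continuous left
   inverse of it.  The product gmul x y is meaningful only on composable pairs,
   i.e. when gsource x = grange y, and its values elsewhere are junk. *)
Record groupoid := Groupoid {
  arrow :> topologicalType;
  unit_space : topologicalType;
  grange : arrow -> unit_space;
  gsource : arrow -> unit_space;
  gunit : unit_space -> arrow;
  gmul : arrow -> arrow -> arrow;
  ginv : arrow -> arrow;
  grange_unit : forall u, grange (gunit u) = u;
  gsource_unit : forall u, gsource (gunit u) = u;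
  grange_mul : forall x y, gsource x = grange y -> grange (gmul x y) = grange x;
  gsource_mul :
    forall x y, gsource x = grange y -> gsource (gmul x y) = gsource y;
  gmulA : forall x y z, gsource x = grange y -> gsource y = grange z ->
    gmul x (gmul y z) = gmul (gmul x y) z;
  gmul1g : forall x, gmul (gunit (grange x)) x = x;
  gmulg1 : forall x, gmul x (gunit (gsource x)) = x;
  grange_inv : forall x, grange (ginv x) = gsource x;
  gsource_inv : forall x, gsource (ginv x) = grange x;
  gmulVg : forall x, gmul (ginv x) x = gunit (gsource x);
  gmulgV : forall x, gmul x (ginv x) = gunit (grange x);
  continuous_grange : continuous grange;
  continuous_gsource : continuous gsource;
  continuous_gunit : continuous gunit;
  continuous_ginv : continuous ginv;
  continuous_gmul :
    {within [set p : arrow * arrow | gsource p.1 = grange p.2],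
      continuous (fun p : arrow * arrow => gmul p.1 p.2)};
  groupoid_locally_compact : locally_compact [set: arrow];
  groupoid_second_countable : @second_countable arrow;
  groupoid_hausdorff : hausdorff_space arrow
}.

Definition etale (G : groupoid) :=
  local_homeomorphism (@grange G) /\ local_homeomorphism (@gsource G).

Definition open_bisection (G : groupoid) (E : set G) :=
  [/\ open E, open (@grange G @` E), open (@gsource G @` E),
      homeo_on (@grange G) E & homeo_on (@gsource G) E].

Definition compact_open_bisection (G : groupoid) (E : set G) :=
  compact E /\ open_bisection E.

Definition ample (G : groupoid) := basis (@compact_open_bisection G).

Record ample_groupoid := AmpleGroupoid {
  ample_base :> groupoid;
  ample_etale : etale ample_base;
  ample_ample : ample ample_base
}.

Section TopologicalLemmas.
Implicit Types X Y : topologicalType.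

Lemma within_continuousP X Y (f : X -> Y) (A : set X) :
  {within A, continuous f} <->
  forall x (W : set Y), A x -> nbhs (f x) W -> \forall y \near x, A y -> W (f y).
Proof.
split=> [/subspace_continuousP cf x W Ax fxW|cf].
  exact: (cf x Ax W fxW).
by apply/subspace_continuousP => x Ax W fxW; apply: cf.
Qed.

Lemma local_homeo_open_map X Y (f : X -> Y) :
  local_homeomorphism f -> open_map f.
Proof.
move=> lf U oU; rewrite openE => _ [x Ux <-].
have [V [oV Vx oFV [_ [g [/within_continuousP cg gK]]]]] := lf x.
have FVx : (f @` V) (f x) by exists x.
have nU : nbhs (g (f x)) U by rewrite gK ?inE//; exact: open_nbhs_nbhs.
have nFV : nbhs (f x) (f @` V) by exact: open_nbhs_nbhs.
apply: filterS2 nFV (cg _ _ FVx nU) => _ [y Vy <-] /(_ (imageP f Vy)).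
by rewrite gK ?inE// => Uy; exists y.
Qed.

Lemma open_map_homeo_on X Y (f : X -> Y) (U : set X) (h : Y -> X) :
  continuous f -> open_map f -> open U ->
  {in U &, injective f} -> homeo_on f U.
Proof.
move=> cf of_ oU injf; split; first exact: continuous_subspaceT.
pose g y := xget (h y) [set x | U x /\ f x = y].
have gK : {in U, cancel f g}.
  move=> x; rewrite inE => Ux.
  have [Ug fg] : U (g (f x)) /\ f (g (f x)) = f x.
    by apply: (xgetI (x := x) (h (f x)) (P := [set x' | U x' /\ f x' = f x])).
  by apply: injf; rewrite ?inE.
exists g; split=> //; apply/within_continuousP => _ W [x Ux <-].
rewrite gK ?inE// nbhsE => -[V [oV Vx] VW].
have oFV : nbhs (f x) (f @` (U `&` V)).
  by apply: open_nbhs_nbhs; split; [exact/of_/openI|exists x].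
apply: filterS oFV => _ [y [Uy Vy] <-] _.
by rewrite gK ?inE//; exact: VW.
Qed.

Lemma continuous_discreteP X (T : choiceType) (f : X -> discrete_topology T) :
  continuous f <-> forall x, \forall y \near x, f y = f x.
Proof.
split=> [cf x|lf x].
  by apply: (cf x [set y | y = f x]); rewrite nbhs_principalE.
move=> W; rewrite nbhs_principalE => /principal_filterP Wx.
by apply: filterS (lf x) => y /= ->.
Qed.
End TopologicalLemmas.

Section GroupoidLemmas.
Variable G : groupoid.
Implicit Types (x y z : G) (u v : unit_space G) (E F : set G).

Lemma ginvK : involutive (@ginv G).
Proof.
move=> x; have cV : gsource (ginv (ginv x)) = grange (ginv x).
  by rewrite gsource_inv.
rewrite -[LHS]gmulg1 gsource_inv grange_inv -gmulVg gmulA//; last first.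
  by rewrite gsource_inv.
by rewrite gmulVg gsource_inv gmul1g.
Qed.

Lemma gmulgK x z : gsource z = gsource x -> gmul (gmul z (ginv x)) x = z.
Proof.
move=> szx; rewrite -gmulA ?grange_inv ?gsource_inv//.
by rewrite gmulVg -szx gmulg1.
Qed.

Lemma gmulKg x y : gsource y = grange x -> gmul (gmul y x) (ginv x) = y.
Proof. by move=> yx; rewrite -gmulA ?grange_inv// gmulgV -yx gmulg1. Qed.

Lemma unit_space_hausdorff : hausdorff_space (unit_space G).
Proof.
move=> u v cuv; rewrite -(gsource_unit u) -(gsource_unit v).
congr gsource; apply: (@groupoid_hausdorff G) => A B Au Bv.
have [w [Aw Bw]] := cuv _ _ (continuous_gunit Au) (continuous_gunit Bv).
by exists (gunit w).
Qed.

Lemma closed_composable :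
  closed [set p : G * G | gsource p.1 = grange p.2].
Proof.
rewrite -openC openE => -[x y] /= sxry.
have : cluster (nbhs (gsource x)) (grange y) -> False.
  by move=> /unit_space_hausdorff.
move=> /existsNP[A] /existsNP[B] /not_implyP[Ax] /not_implyP[By AB0].
exists (@gsource G @^-1` A, @grange G @^-1` B) => /=.
  by split; [exact: continuous_gsource|exact: continuous_grange].
by move=> -[x' y'] /= [Ax' By'] e; apply: AB0; exists (gsource x'); split=> //; rewrite e.
Qed.

Lemma compact_open_bisectionP E : etale G ->
  compact_open_bisection E <->
  [/\ compact E, open E, {in E &, injective (@grange G)} &
      {in E &, injective (@gsource G)}].
Proof.
move=> [lr ls]; split=> [[cE [oE _ _ [_ [g [_ gK]]] [_ [h [_ hK]]]]]|].
  by split; [| |exact: can_in_inj gK|exact: can_in_inj hK].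
move=> [cE oE injr injs]; split=> //.
split=> //; [exact: local_homeo_open_map|exact: local_homeo_open_map| |].
- apply: (open_map_homeo_on (@gunit G)) => //; first exact: continuous_grange.
  exact: local_homeo_open_map.
- apply: (open_map_homeo_on (@gunit G)) => //; first exact: continuous_gsource.
  exact: local_homeo_open_map.
Qed.

Lemma compact_open_bisection0 : etale G -> @compact_open_bisection G set0.
Proof.
move=> eG; apply/compact_open_bisectionP => //; split.
- exact: compact0.
- exact: open0.
- by move=> x y; rewrite inE.
- by move=> x y; rewrite inE.
Qed.

Lemma compact_open_bisection_inv E : etale G ->
  compact_open_bisection E -> compact_open_bisection (@ginv G @` E).
Proof.
move=> eG /(compact_open_bisectionP _ eG)[cE oE injr injs].
apply/compact_open_bisectionP => //; split.
- apply: continuous_compact => //; apply: continuous_subspaceT.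
  exact: continuous_ginv.
- have -> : @ginv G @` E = @ginv G @^-1` E.
    apply/seteqP; split=> [_ [x Ex <-] /=|x /= Ex]; first by rewrite ginvK.
    by exists (ginv x) => //; rewrite ginvK.
  by move/continuousP : (@continuous_ginv G); exact.
- move=> _ _ /set_mem[x Ex <-] /set_mem[y Ey <-]; rewrite !grange_inv.
  by move=> /injs ->//; rewrite inE.
- move=> _ _ /set_mem[x Ex <-] /set_mem[y Ey <-]; rewrite !gsource_inv.
  by move=> /injr ->//; rewrite inE.
Qed.

Lemma compact_open_bisection_unit (A : set (unit_space G)) : etale G ->
  compact A -> open A -> compact_open_bisection (@gunit G @` A).
Proof.
move=> eG cA oA; apply/compact_open_bisectionP => //; split.
- apply: continuous_compact => //; apply: continuous_subspaceT.
  exact: continuous_gunit.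
- rewrite openE => _ [u Au <-].
  have [V [oV Vu _ [_ [g [_ gK]]]]] := eG.2 (gunit u).
  have nV : nbhs (gunit u) V by exact: open_nbhs_nbhs.
  have nA : nbhs (gsource (gunit u)) (A `&` @gunit G @^-1` V).
    rewrite gsource_unit; apply: filterI; first exact: open_nbhs_nbhs.
    exact: continuous_gunit.
  rewrite /interior/=.
  apply: filterS2 nV (continuous_gsource nA) => y Vy [/= Ay Vsy].
  exists (gsource y) => //.
  have injV := can_in_inj gK.
  by apply: injV; rewrite ?inE// gsource_unit.
- by move=> _ _ /set_mem[x Ex <-] /set_mem[y Ey <-]; rewrite !grange_unit => ->.
- by move=> _ _ /set_mem[x Ex <-] /set_mem[y Ey <-]; rewrite !gsource_unit => ->.
Qed.

Lemma compact_open_bisectionI E F : etale G -> clopen F ->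
  compact_open_bisection E -> compact_open_bisection (E `&` F).
Proof.
move=> eG [oF cF] /(compact_open_bisectionP _ eG)[cE oE injr injs].
apply/compact_open_bisectionP => //; split.
- exact: compact_closedI.
- exact: openI.
- move=> x y /set_mem[Ex _] /set_mem[Ey _]; apply: injr; exact/mem_set.
- move=> x y /set_mem[Ex _] /set_mem[Ey _]; apply: injs; exact/mem_set.
Qed.

Definition bisection_mul F E : set G :=
  (fun p : G * G => gmul p.1 p.2) @`
    ((F `*` E) `&` [set p | gsource p.1 = grange p.2]).

Lemma compact_open_bisection_mul F E : etale G ->
  compact_open_bisection F -> compact_open_bisection E ->
  compact_open_bisection (bisection_mul F E).
Proof.
move=> eG /(compact_open_bisectionP _ eG)[cF oF injrF injsF].
move=> /(compact_open_bisectionP _ eG)[cE oE injrE injsE].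
apply/compact_open_bisectionP => //; split.
- apply: continuous_compact.
    apply: continuous_subspaceW (@continuous_gmul G).
    by move=> p [].
  by apply: compact_closedI; [exact: compact_setX|exact: closed_composable].
- rewrite openE => _ [[y x] [[/= Fy Ex] yx] <-].
  rewrite /interior; have /within_continuousP cm := @continuous_gmul G.
  have c0 : gsource (gmul y x) = grange (ginv x).
    by rewrite gsource_mul// grange_inv.
  have nF : nbhs (gmul (gmul y x) (ginv x)) F.
    by rewrite gmulKg//; exact: open_nbhs_nbhs.
  have [[P Q] /= [nP nQ] PQ] := cm (gmul y x, ginv x) F c0 nF.
  have nE : nbhs x (E `&` @ginv G @^-1` Q).
    by apply: filterI; [exact: open_nbhs_nbhs|exact: continuous_ginv].
  move: nE; rewrite nbhsE => -[U [oU Ux] UEQ].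
  have nU : nbhs (gsource (gmul y x)) (@gsource G @` U).
    apply: open_nbhs_nbhs; split; last by exists x; rewrite ?gsource_mul.
    exact: (local_homeo_open_map eG.2).
  apply: filterS2 nP (continuous_gsource nU) => z Pz [x' Ux' sx'].
  have [Ex' Qx'] := UEQ _ Ux'.
  have Fz : F (gmul z (ginv x')).
    by apply: (PQ (z, ginv x')) => //=; rewrite grange_inv.
  exists (gmul z (ginv x'), x') => /=; last by rewrite gmulgK.
  by split=> //; rewrite gsource_mul ?gsource_inv ?grange_inv.
- move=> _ z /set_mem[[y x] [[/= Fy Ex] yx] <-].
  move=> /set_mem[[y' x'] [[/= Fy' Ex'] yx'] <-].
  rewrite !grange_mul// => /injrF yy'.
  have {}yy' : y = y' by apply: yy'; rewrite inE.
  have xx' : x = x' by apply: injrE; rewrite ?inE// -yx -yx' yy'.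
  by rewrite yy' xx'.
- move=> _ z /set_mem[[y x] [[/= Fy Ex] yx] <-].
  move=> /set_mem[[y' x'] [[/= Fy' Ex'] yx'] <-].
  rewrite !gsource_mul// => /injsE xx'.
  have {}xx' : x = x' by apply: xx'; rewrite inE.
  have yy' : y = y' by apply: injsF; rewrite ?inE// yx yx' xx'.
  by rewrite yy' xx'.
Qed.

End GroupoidLemmas.

Section CcDefinition.
Variable X : topologicalType.
Implicit Types f g : X -> int.

(* Membership in C_c(X, Z)^+, with Z discrete. *)
Definition is_Cc_pos f : Prop :=
  [/\ continuous (f : X -> discrete_topology int),
      compact (closure [set u | f u != 0]) & forall u, 0 <= f u].

Definition Cc_pos_pred : {pred X -> int} := fun f => `[< is_Cc_pos f >].

Record Cc_pos := CcPos { Cc_fun :> X -> int; _ : Cc_pos_pred Cc_fun }.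

HB.instance Definition _ := [isSub for Cc_fun].
HB.instance Definition _ := [Choice of Cc_pos by <:].

Lemma Cc_posP (f : Cc_pos) : is_Cc_pos f.
Proof. by case: f => f /= /asboolP. Qed.

Fact Cc_pos_nmod_closed : GRing.nmod_closed Cc_pos_pred.
Proof.
split=> [|f g /asboolP[cf sf f0] /asboolP[cg sg g0]]; apply/asboolP; split=> //.
- by apply/continuous_discreteP => x; exact: nearW.
- rewrite (_ : [set u | _] = set0) ?closure0; first exact: compact0.
  by apply/seteqP; split=> u //=; rewrite eqxx.
- apply/continuous_discreteP => x.
  move/continuous_discreteP : cf => /(_ x) cf.
  move/continuous_discreteP : cg => /(_ x) cg.
  by apply: filterS2 cf cg => y fy gy; rewrite !fctE fy gy.
- apply: (@subclosed_compact _ _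
    (closure [set u | f u != 0] `|` closure [set u | g u != 0])).
  + exact: closed_closure.
  + exact: compactU.
  + rewrite -closureU; apply: closureS => u /=.
    by apply: contraPP => /not_orP[/negP/negbNE/eqP fu /negP/negbNE/eqP gu];
      rewrite fctE fu gu addr0 eqxx.
- by move=> u; rewrite fctE addr_ge0.
Qed.

HB.instance Definition _ :=
  GRing.SubChoice_isSubNmodule.Build (X -> int) Cc_pos_pred Cc_pos
    Cc_pos_nmod_closed.

End CcDefinition.

(* The relation f ~_G g, whose quotient is the type semigroup S(G). *)
Definition type_equiv (G : groupoid) (f g : Cc_pos (unit_space G)) : Prop :=
  exists (n : nat) (E : 'I_n -> set G),
    [/\ forall i, compact_open_bisection (E i),
        forall u, f u = \sum_(i < n) \1_(@gsource G @` E i) u &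
        forall u, g u = \sum_(i < n) \1_(@grange G @` E i) u].

Section Matching.
Local Open Scope nat_scope.

Lemma sum_rank (b : nat -> bool) k m :
  \sum_(j < m) (b j && (k == \sum_(i < j) b i)) = (k < \sum_(j < m) b j).
Proof.
elim: m => [|m IHm]; first by rewrite !big_ord0.
rewrite !big_ord_recr/= IHm; case: (b m) => /=; last by rewrite !addn0.
by rewrite addn1 ltnS; case: ltngtP.
Qed.

Lemma sum_rank_eq (a b : nat -> bool) n m i :
  \sum_(j < n) a j = \sum_(j < m) b j -> i < n -> a i ->
  \sum_(j < m) (b j && (\sum_(l < i) a l == \sum_(l < j) b l)) = 1.
Proof.
move=> ab iltn ai; rewrite sum_rank -ab.
suff -> : \sum_(l < i) a l < \sum_(j < n) a j by [].
rewrite -(subnKC iltn) big_split_ord/= big_ord_recr/= ai.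
by rewrite addn1 ltn_addr.
Qed.

End Matching.

Section TypeEquiv.
Variable G : groupoid.
Hypothesis eG : etale G.
Implicit Types (f g h : Cc_pos (unit_space G)).

Lemma type_equiv_nat f g : type_equiv f g <->
  exists (n : nat) (E : nat -> set G),
    [/\ forall i, compact_open_bisection (E i),
        forall u, f u = \sum_(i < n) \1_(@gsource G @` E i) u &
        forall u, g u = \sum_(i < n) \1_(@grange G @` E i) u].
Proof.
split=> [[n [E [bE fE gE]]]|[n [E [bE fE gE]]]].
  exists n, (fun k => if insub k is Some i then E i else set0); split.
  - move=> k; case: insubP => [i _ _|_]; first exact: bE.
    exact: compact_open_bisection0.
  - by move=> u; rewrite fE; apply: eq_bigr => i _; rewrite valK.
  - by move=> u; rewrite gE; apply: eq_bigr => i _; rewrite valK.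
by exists n, (fun i => E i); split.
Qed.

Lemma type_equiv_fin f g (I : finType) (E : I -> set G) :
  (forall i, compact_open_bisection (E i)) ->
  (forall u, f u = \sum_i \1_(@gsource G @` E i) u) ->
  (forall u, g u = \sum_i \1_(@grange G @` E i) u) -> type_equiv f g.
Proof.
move=> bE fE gE; exists #|I|, (fun k => E (enum_val k)); split=> // u.
- by rewrite fE (reindex (@enum_val I I))//; exact/onW_bij/enum_val_bij.
- by rewrite gE (reindex (@enum_val I I))//; exact/onW_bij/enum_val_bij.
Qed.

Lemma Cc_pos_bounded (X : topologicalType) (f : Cc_pos X) :
  exists N : nat, forall u, f u <= N%:Z.
Proof.
have [/continuous_discreteP cf /compact_near_coveringP Kf f0] := Cc_posP f.
have [] := Kf nat \oo (fun (n : nat) u => f u <= n%:Z).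
- move=> u _; near=> v n => /=.
  have -> : f v = f u by near: v; exact: cf.
  rewrite -(gez0_abs (f0 u)) lez_nat; near: n.
  exact: nbhs_infty_ge.
- move=> N _ /(_ N (leqnn N)) suppN; exists N => u.
  have [fu0|fu0] := eqVneq (f u) 0; first by rewrite fu0.
  by apply: suppN; apply: subset_closure.
Unshelve. all: by end_near. Qed.

Lemma compact_superlevel (X : topologicalType) (f : Cc_pos X) (n : nat) :
  compact [set u | n%:Z < f u] /\ open [set u | n%:Z < f u].
Proof.
have [/continuous_discreteP cf Kf f0] := Cc_posP f; split.
  apply: subclosed_compact Kf _.
    rewrite -openC openE => u /= fu; rewrite /interior/=.
    by apply: filterS (cf u) => v /= ->.
  move=> u /= fu; apply: subset_closure => /=.
  by rewrite gt_eqF// (le_lt_trans _ fu).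
rewrite openE => u /= fu; rewrite /interior/=.
by apply: filterS (cf u) => v /= ->.
Qed.

Lemma sum_superlevel (k N : nat) : (k <= N)%N ->
  (\sum_(i < N) (i < k))%N = k.
Proof.
move=> kN; rewrite -(subnKC kN) big_split_ord/= (eq_bigr (fun=> 1%N)).
  rewrite sum1_card card_ord big1 ?addn0// => i _.
  by rewrite ltnNge leq_addr.
by move=> i _; rewrite ltn_ord.
Qed.

Lemma type_equiv_refl f : type_equiv f f.
Proof.
have [N fN] := Cc_pos_bounded f.
have [_ _ f0] := Cc_posP f.
pose A (i : 'I_N) := [set u | (i : nat)%:Z < f u].
have fE u : f u = \sum_(i < N) \1_(A i) u.
  rewrite -(gez0_abs (f0 u)) -{1}(@sum_superlevel `|f u|%N N).
    rewrite (big_morph Posz PoszD (erefl _)); apply: eq_bigr => i _; rewrite indicE /A natz.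
    congr (Posz (nat_of_bool _)); apply/idP/idP => [fi|/set_mem/=].
      by apply/mem_set; rewrite /= -(gez0_abs (f0 u)).
    by rewrite -{1}(gez0_abs (f0 u)).
  by rewrite -lez_nat gez0_abs.
exists N, (fun i => @gunit G @` A i); split.
- move=> i; have [cA oA] := compact_superlevel f i.
  exact: compact_open_bisection_unit.
- move=> u; rewrite fE; apply: eq_bigr => i _; congr (\1_ _ u).
  rewrite image_comp (_ : _ \o _ = id) ?image_id//.
  by apply/funext => v /=; rewrite gsource_unit.
- move=> u; rewrite fE; apply: eq_bigr => i _; congr (\1_ _ u).
  rewrite image_comp (_ : _ \o _ = id) ?image_id//.
  by apply/funext => v /=; rewrite grange_unit.
Qed.

Lemma type_equiv_sym f g : type_equiv f g -> type_equiv g f.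
Proof.
move=> [n [E [bE fE gE]]]; exists n, (fun i => @ginv G @` E i); split.
- by move=> i; exact: compact_open_bisection_inv.
- move=> u; rewrite gE; apply: eq_bigr => i _; congr (\1_ _ u).
  by rewrite image_comp; apply: eq_imagel => x _ /=; rewrite gsource_inv.
- move=> u; rewrite fE; apply: eq_bigr => i _; congr (\1_ _ u).
  by rewrite image_comp; apply: eq_imagel => x _ /=; rewrite grange_inv.
Qed.

Lemma type_equivD f1 f2 g1 g2 : type_equiv f1 g1 -> type_equiv f2 g2 ->
  type_equiv (f1 + f2) (g1 + g2).
Proof.
move=> [n [E [bE fE gE]]] [m [F [bF fF gF]]].
apply: (@type_equiv_fin _ _ ('I_n + 'I_m)%type
  (fun k => match k with inl i => E i | inr j => F j end)).
- by case.
- by move=> u; rewrite big_sumType/= -fE -fF.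
- by move=> u; rewrite big_sumType/= -gE -gF.
Qed.

Lemma clopen_locally_constant (X : topologicalType) (A : set X) :
  clopen A <-> forall u, \forall v \near u, (v \in A) = (u \in A).
Proof.
split=> [[oA cA] u|lA].
  have [Au|nAu] := pselect (A u).
    apply: filterS (open_nbhs_nbhs (conj oA Au)) => v Av.
    by rewrite !mem_set.
  apply: filterS (open_nbhs_nbhs (conj (closed_openC cA) nAu)) => v nAv.
  by rewrite !memNset.
split.
  rewrite openE => u Au; rewrite /interior.
  by apply: filterS (lA u) => v; rewrite (mem_set Au) => /set_mem.
rewrite -openC openE => u nAu; rewrite /interior.
apply: filterS (lA u) => v; rewrite (memNset nAu) => + Av.
by rewrite (mem_set Av).
Qed.

Lemma clopen_bisection_range E : compact_open_bisection E ->
  clopen (@grange G @` E).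
Proof.
move=> [cE [_ orE _ _ _]]; split=> //.
apply: compact_closed; first exact: unit_space_hausdorff.
apply: continuous_compact cE.
exact/continuous_subspaceT/continuous_grange.
Qed.

Lemma clopen_bisection_source E : compact_open_bisection E ->
  clopen (@gsource G @` E).
Proof.
move=> [cE [_ _ osE _ _]]; split=> //.
apply: compact_closed; first exact: unit_space_hausdorff.
apply: continuous_compact cE.
exact/continuous_subspaceT/continuous_gsource.
Qed.

Lemma clopen_equal_rank (X : topologicalType) (A B : nat -> set X) i j :
  (forall l, clopen (A l)) -> (forall l, clopen (B l)) ->
  clopen [set u | [&& u \in A i, u \in B j &
    (\sum_(l < i) (u \in A l) == \sum_(l < j) (u \in B l))%N]].
Proof.
move=> cA cB; apply/clopen_locally_constant => u.
have nearA : \forall v \near u, forall l : 'I_i.+1, (v \in A l) = (u \in A l).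
  by apply: filter_forall => l; apply: (clopen_locally_constant (A l)).1.
have nearB : \forall v \near u, forall l : 'I_j.+1, (v \in B l) = (u \in B l).
  by apply: filter_forall => l; apply: (clopen_locally_constant (B l)).1.
apply: filterS2 nearA nearB => v Av Bv.
have eqA k : (k <= i)%N -> (v \in A k) = (u \in A k).
  by rewrite -ltnS => ki; exact: (Av (Ordinal ki)).
have eqB k : (k <= j)%N -> (v \in B k) = (u \in B k).
  by rewrite -ltnS => kj; exact: (Bv (Ordinal kj)).
have sumA : (\sum_(l < i) (v \in A l) = \sum_(l < i) (u \in A l))%N.
  by apply: eq_bigr => l _; rewrite eqA// ltnW.
have sumB : (\sum_(l < j) (v \in B l) = \sum_(l < j) (u \in B l))%N.
  by apply: eq_bigr => l _; rewrite eqB// ltnW.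
by apply/idP/idP => /set_mem/= uC; apply/mem_set; move: uC;
  rewrite /= sumA sumB eqA// eqB.
Qed.

Lemma type_equiv_trans g f h :
  type_equiv f g -> type_equiv g h -> type_equiv f h.
Proof.
move=> /type_equiv_nat[n [E [bE fE gE]]] /type_equiv_nat[m [F [bF gF hF]]].
pose a u l := u \in @grange G @` E l.
pose b u l := u \in @gsource G @` F l.
pose C i j := [set u | [&& a u i, b u j &
  (\sum_(l < i) a u l == \sum_(l < j) b u l)%N]].
have clC i j : clopen (C i j).
  apply: (@clopen_equal_rank _ (fun l => @grange G @` E l)
    (fun l => @gsource G @` F l)) => l.
    exact: clopen_bisection_range.
  exact: clopen_bisection_source.
have ab u : (\sum_(i < n) a u i = \sum_(j < m) b u j)%N.
  apply/eqP; rewrite -eqz_nat; apply/eqP.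
  transitivity (g u).
    rewrite gE (big_morph Posz PoszD (erefl _)); apply: eq_bigr => i _.
    by rewrite indicE natz.
  rewrite gF (big_morph Posz PoszD (erefl _)); apply: eq_bigr => i _.
  by rewrite indicE natz.
pose T i j := bisection_mul (F j `&` @gsource G @^-1` C i j)
                            (E i `&` @grange G @^-1` C i j).
have bT i j : compact_open_bisection (T i j).
  apply: compact_open_bisection_mul => //; apply: compact_open_bisectionI => //.
    by apply: preimage_clopen => //; exact: continuous_gsource.
  by apply: preimage_clopen => //; exact: continuous_grange.
have sT i j v : (@gsource G @` T i j) v <->
    exists x, [/\ E i x, C i j (grange x) & gsource x = v].
  split=> [[_ [[y x] [[/= _ [Ex Cx]] yx] <-] <-]|[x [Ex Cx <-]]].
    by exists x; split=> //; rewrite gsource_mul.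
  have /and3P[_ /set_mem[y Fy yx] _] := Cx.
  exists (gmul y x); last by rewrite gsource_mul.
  by exists (y, x) => //; split=> //; split; split=> //=; rewrite yx.
have rT i j v : (@grange G @` T i j) v <->
    exists y, [/\ F j y, C i j (gsource y) & grange y = v].
  split=> [[_ [[y x] [[/= [Fy Cy] _] yx] <-] <-]|[y [Fy Cy <-]]].
    by exists y; split=> //; rewrite grange_mul.
  have /and3P[/set_mem[x Ex yx] _ _] := Cy.
  exists (gmul y x); last by rewrite grange_mul.
  by exists (y, x) => //; split=> //; split; split=> //=; rewrite yx.
apply: (@type_equiv_fin _ _ ('I_n * 'I_m)%type (fun p => T p.1 p.2)) => //.
- move=> v; rewrite fE -(pair_big xpredT xpredT
    (fun (i : 'I_n) (j : 'I_m) => \1_(@gsource G @` T i j) v : int))/=.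
  apply: eq_bigr => i _; rewrite indicE.
  have [[x Ex xv]|nEv] := pselect ((@gsource G @` E i) v); last first.
    rewrite memNset// big1// => j _; rewrite indicE memNset// => /sT[x [Ex _ xv]].
    by apply: nEv; exists x.
  rewrite mem_set; last by exists x.
  have ax : a (grange x) i by apply/mem_set; exists x.
  have /(congr1 Posz) := sum_rank_eq (ab (grange x)) (ltn_ord i) ax.
  rewrite (big_morph Posz PoszD (erefl _)) => sum1.
  rewrite -[LHS]/(Posz 1) -sum1.
  apply: eq_bigr => j _; rewrite indicE natz; congr (Posz (nat_of_bool _)).
  apply/idP/idP => [bc|/set_mem/sT[x' [Ex' /and3P[_ bx' cx'] x'v]]].
    by apply/mem_set/sT; exists x; split=> //; rewrite /C/= ax.
  have /(compact_open_bisectionP _ eG)[_ _ _ injs] := bE i.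
  have -> : x = x' by apply: injs; rewrite ?inE// xv.
  by rewrite bx'.
- move=> v; rewrite hF -(pair_big xpredT xpredT
    (fun (i : 'I_n) (j : 'I_m) => \1_(@grange G @` T i j) v : int))/=.
  rewrite exchange_big/=.
  apply: eq_bigr => j _; rewrite indicE.
  have [[y Fy yv]|nFv] := pselect ((@grange G @` F j) v); last first.
    rewrite memNset// big1// => i _; rewrite indicE memNset// => /rT[y [Fy _ yv]].
    by apply: nFv; exists y.
  rewrite mem_set; last by exists y.
  have by_ : b (gsource y) j by apply/mem_set; exists y.
  have /(congr1 Posz) := sum_rank_eq (esym (ab (gsource y))) (ltn_ord j) by_.
  rewrite (big_morph Posz PoszD (erefl _)) => sum1.
  rewrite -[LHS]/(Posz 1) -sum1.
  apply: eq_bigr => i _; rewrite indicE natz; congr (Posz (nat_of_bool _)).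
  apply/idP/idP => [/andP[ac cc]|/set_mem/rT[y' [Fy' /and3P[ay' _ cy'] y'v]]].
    by apply/mem_set/rT; exists y; split=> //; rewrite /C/= by_ ac eq_sym.
  have /(compact_open_bisectionP _ eG)[_ _ injr _] := bF j.
  have -> : y = y' by apply: injr; rewrite ?inE// yv.
  by rewrite ay' eq_sym.
Qed.

End TypeEquiv.

Section TypeSemigroup.
Variable G : ample_groupoid.

Definition type_equivb : rel (Cc_pos (unit_space G)) :=
  fun f g => `[< type_equiv f g >].

Fact type_equivb_refl : reflexive type_equivb.
Proof. move=> f; apply/asboolP/type_equiv_refl/ample_etale. Qed.

Fact type_equivb_sym : symmetric type_equivb.
Proof.
by move=> f g; apply/asboolP/asboolP; apply/type_equiv_sym/ample_etale.
Qed.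

Fact type_equivb_trans : transitive type_equivb.
Proof.
move=> g f h /asboolP fg /asboolP gh; apply/asboolP.
exact: type_equiv_trans (@ample_etale G) _ _ _ fg gh.
Qed.

Canonical type_equiv_rel :=
  EquivRel type_equivb type_equivb_refl type_equivb_sym type_equivb_trans.

Definition type_semigroup := {eq_quot type_equiv_rel}.
HB.instance Definition _ := EqQuotient.on type_semigroup.
HB.instance Definition _ := Choice.on type_semigroup.

Definition type_class (f : Cc_pos (unit_space G)) : type_semigroup :=
  \pi_type_semigroup f.

Definition type_semigroup_add (x y : type_semigroup) : type_semigroup :=
  type_class (repr x + repr y).

Lemma type_class_eq f g : type_class f = type_class g <-> type_equiv f g.
Proof. by split=> [/eqmodP/asboolP|fg]; last exact/eqmodP/asboolP. Qed.

Lemma type_class_repr x : type_class (repr x) = x.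
Proof. exact: reprK. Qed.

Lemma type_class_add f g :
  type_semigroup_add (type_class f) (type_class g) = type_class (f + g).
Proof.
apply/type_class_eq; apply: type_equivD.
by apply/type_class_eq; rewrite type_class_repr.
by apply/type_class_eq; rewrite type_class_repr.
Qed.

Fact type_semigroup_addA : associative type_semigroup_add.
Proof.
move=> x y z; rewrite -[x]type_class_repr -[y]type_class_repr.
by rewrite -[z]type_class_repr !type_class_add addrA.
Qed.

Fact type_semigroup_addC : commutative type_semigroup_add.
Proof. by move=> x y; rewrite /type_semigroup_add addrC. Qed.

Fact type_semigroup_add0 : left_id (type_class 0) type_semigroup_add.
Proof.
by move=> x; rewrite -[x]type_class_repr type_class_add add0r.
Qed.

HB.instance Definition _ := GRing.isNmodule.Build type_semigroup
  type_semigroup_addA type_semigroup_addC type_semigroup_add0.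

Lemma type_class0 : type_class 0 = 0. Proof. by []. Qed.

Lemma type_classD f g : type_class (f + g) = type_class f + type_class g.
Proof. by rewrite -type_class_add. Qed.

End TypeSemigroup.

Section Actions.
Variables (G : groupoid) (Z : topologicalType).

(* lact g z is meaningful only when gsource g = lanchor z. *)
Record left_action := LeftAction {
  lanchor : Z -> unit_space G;
  lact : G -> Z -> Z;
  lanchor_act : forall g z, gsource g = lanchor z ->
    lanchor (lact g z) = grange g;
  lact1 : forall z, lact (gunit (lanchor z)) z = z;
  lactM : forall g h z, gsource g = grange h -> gsource h = lanchor z ->
    lact (gmul g h) z = lact g (lact h z);
  continuous_lanchor : continuous lanchor;
  continuous_lact :
    {within [set p : G * Z | gsource p.1 = lanchor p.2],
      continuous (fun p : G * Z => lact p.1 p.2)}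
}.

(* ract z g is meaningful only when ranchor z = grange g. *)
Record right_action := RightAction {
  ranchor : Z -> unit_space G;
  ract : Z -> G -> Z;
  ranchor_act : forall z g, ranchor z = grange g ->
    ranchor (ract z g) = gsource g;
  ract1 : forall z, ract z (gunit (ranchor z)) = z;
  ractM : forall z g h, ranchor z = grange g -> gsource g = grange h ->
    ract z (gmul g h) = ract (ract z g) h;
  continuous_ranchor : continuous ranchor;
  continuous_ract :
    {within [set p : Z * G | ranchor p.1 = grange p.2],
      continuous (fun p : Z * G => ract p.1 p.2)}
}.

Definition free_left_action (L : left_action) :=
  forall g z, gsource g = lanchor L z -> lact L g z = z ->
    g = gunit (lanchor L z).

Definition free_right_action (R : right_action) :=
  forall z g, ranchor R z = grange g -> ract R z g = z ->
    g = gunit (ranchor R z).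

(* The map (g, z) |-> (g z, z), from the fibre product of composable pairs to
   Z * Z, is proper: preimages of compact sets are compact. *)
Definition proper_left_action (L : left_action) :=
  forall K : set (Z * Z), compact K ->
    compact [set p : G * Z | gsource p.1 = lanchor L p.2 /\
                             K (lact L p.1 p.2, p.2)].

Definition proper_right_action (R : right_action) :=
  forall K : set (Z * Z), compact K ->
    compact [set p : Z * G | ranchor R p.1 = grange p.2 /\
                             K (p.1, ract R p.1 p.2)].

Section LeftOrbits.
Variable L : left_action.

Definition left_orbit : rel Z :=
  fun z z' => `[< exists2 g, gsource g = lanchor L z & lact L g z = z' >].

Fact left_orbit_refl : reflexive left_orbit.
Proof.
by move=> z; apply/asboolP; exists (gunit (lanchor L z));
  rewrite ?gsource_unit ?lact1.
Qed.

Fact left_orbit_sym : symmetric left_orbit.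
Proof.
suff imp z z' : left_orbit z z' -> left_orbit z' z.
  by move=> z z'; apply/idP/idP; exact: imp.
move=> /asboolP[g gz <-]; apply/asboolP; exists (ginv g).
  by rewrite gsource_inv lanchor_act.
by rewrite -lactM ?gsource_inv// gmulVg gz lact1.
Qed.

Fact left_orbit_trans : transitive left_orbit.
Proof.
move=> z2 z1 z3 /asboolP[g gz1 <-] /asboolP[h].
rewrite lanchor_act// => hg <-; apply/asboolP; exists (gmul h g).
  by rewrite gsource_mul.
by rewrite lactM.
Qed.

Canonical left_orbit_rel :=
  EquivRel left_orbit left_orbit_refl left_orbit_sym left_orbit_trans.

Definition left_orbit_space := quotient_topology {eq_quot left_orbit_rel}.

Definition left_orbit_class (z : Z) : left_orbit_space :=
  \pi_{eq_quot left_orbit_rel} z.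

End LeftOrbits.

Section RightOrbits.
Variable R : right_action.

Definition right_orbit : rel Z :=
  fun z z' => `[< exists2 g, ranchor R z = grange g & ract R z g = z' >].

Fact right_orbit_refl : reflexive right_orbit.
Proof.
by move=> z; apply/asboolP; exists (gunit (ranchor R z));
  rewrite ?grange_unit ?ract1.
Qed.

Fact right_orbit_sym : symmetric right_orbit.
Proof.
suff imp z z' : right_orbit z z' -> right_orbit z' z.
  by move=> z z'; apply/idP/idP; exact: imp.
move=> /asboolP[g gz <-]; apply/asboolP; exists (ginv g).
  by rewrite grange_inv ranchor_act.
by rewrite -ractM ?grange_inv// gmulgV -gz ract1.
Qed.

Fact right_orbit_trans : transitive right_orbit.
Proof.
move=> z2 z1 z3 /asboolP[g gz1 <-] /asboolP[h].
rewrite ranchor_act// => hg <-; apply/asboolP; exists (gmul g h).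
  by rewrite grange_mul.
by rewrite ractM.
Qed.

Canonical right_orbit_rel :=
  EquivRel right_orbit right_orbit_refl right_orbit_sym right_orbit_trans.

Definition right_orbit_space := quotient_topology {eq_quot right_orbit_rel}.

Definition right_orbit_class (z : Z) : right_orbit_space :=
  \pi_{eq_quot right_orbit_rel} z.

End RightOrbits.
End Actions.

Definition commuting_actions (G H : groupoid) (Z : topologicalType)
    (L : left_action G Z) (R : right_action H Z) :=
  [/\ forall g z, gsource g = lanchor L z ->
        ranchor R (lact L g z) = ranchor R z,
      forall z h, ranchor R z = grange h ->
        lanchor L (ract R z h) = lanchor L z &
      forall g z h, gsource g = lanchor L z -> ranchor R z = grange h ->
        ract R (lact L g z) h = lact L g (ract R z h)].

Definition induces_homeomorphism (Z Q U : topologicalType)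
    (q : Z -> Q) (f : Z -> U) :=
  exists F : Q -> U, homeomorphism F /\ forall z, F (q z) = f z.

(* (L, R) makes Z a G-H equivalence in the sense of Muhly-Renault-Williams. *)
Record is_equivalence (G H : groupoid) (Z : topologicalType)
    (L : left_action G Z) (R : right_action H Z) : Prop := IsEquivalence {
  equivalence_locally_compact : locally_compact [set: Z];
  equivalence_hausdorff : hausdorff_space Z;
  equivalence_commuting : commuting_actions L R;
  equivalence_free_left : free_left_action L;
  equivalence_free_right : free_right_action R;
  equivalence_proper_left : proper_left_action L;
  equivalence_proper_right : proper_right_action R;
  equivalence_open_left : open_map (lanchor L);
  equivalence_open_right : open_map (ranchor R);
  equivalence_surj_left : forall u, exists z, lanchor L z = u;
  equivalence_surj_right : forall v, exists z, ranchor R z = v;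
  equivalence_quotient_right :
    induces_homeomorphism (right_orbit_class R) (lanchor L);
  equivalence_quotient_left :
    induces_homeomorphism (left_orbit_class L) (ranchor R)
}.

Definition groupoid_equivalent (G H : groupoid) :=
  exists (Z : topologicalType) (L : left_action G Z) (R : right_action H Z),
    is_equivalence L R.

(* Main.v *)
Require Import Defs.
From HB Require Import structures.
From mathcomp Require Import all_boot all_order all_algebra.
From mathcomp Require Import all_classical topology numfun.

Set Implicit Arguments.
Unset Strict Implicit.
Unset Printing Implicit Defensive.

Import GRing.Theory.

Local Open Scope classical_set_scope.
Local Open Scope ring_scope.

(** Let Z be an equivalence between G and H, with anchor maps rho to the units
of G and sigma to the units of H.  Call a compact open subset of Z a slice when
both rho and sigma are injective on it: slices play for Z the role that compact
open bisections play for a groupoid.  They give a relation f ~_Z h between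
non-negative compactly supported continuous integer-valued functions f on the
units of G and h on those of H, namely f = sum_i 1_{rho(B_i)} and
h = sum_i 1_{sigma(B_i)} for finitely many slices B_i; the isomorphism sends
[f]_G to [h]_H whenever f ~_Z h.

This makes sense because ~_Z is total on both sides, additive and compatible
with the two type equivalences.

Compatibility is a general fact on composing such relations
([slice_equiv_comp]): two decompositions of the same function into indicators of
clopen sets have a common refinement ([equal_sum_refinement]), so it is enough
to compose a slice E with a slice F such that the outgoing image of E is the
incoming image of F.  Two such compositions are needed.  A bisection E and a
slice B give the slice E.B ([slice_mul]); two slices B and B' with the same
image under sigma give the bisection of all g with g b in B' for some b in B
([slice_div]), which is compact because the action is proper, and on which
source and range are injective because the action is free.  Hence f ~_Z h
depends only on the type classes, and each class determines the other.

Totality needs slices through every point of Z.  As G is etale, its units are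
open in it, so freeness and properness of the action make sigma, whose fibres
are the orbits, locally injective ([principal_locally_injective]); symmetrically
so is rho, and compact open sets of units then pull back to slices
([slice_nbhd]).  A compact open set of units is covered by finitely many images
of slices, which can be made disjoint ([slice_equiv_total]).

Everything about the action of H is obtained from the left case by turning the
right action into the left action h.z = z h^-1 ([rev_action]). *)

(** * Common refinements *)

Section Refinement.
Variable X : topologicalType.

(** [C i j] consists of the points u of [A i] and [B j] such that [A i] and
[B j] have the same rank among, respectively, the sets [A] and the sets [B] that
contain u: at each point, equality of the two sums makes this a bijection
between those sets. *)
Lemma equal_sum_refinement (A B : nat -> set X) n m :
  (forall i, clopen (A i)) -> (forall j, clopen (B j)) ->
  (forall u, \sum_(i < n) \1_(A i) u = \sum_(j < m) \1_(B j) u :> int) ->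
  exists C : nat -> nat -> set X,
    [/\ forall i j, clopen (C i j), forall i j, C i j `<=` A i `&` B j,
        forall i u, (i < n)%N -> \1_(A i) u = \sum_(j < m) \1_(C i j) u :> int &
        forall j u, (j < m)%N -> \1_(B j) u = \sum_(i < n) \1_(C i j) u :> int].
Proof.
move=> cA cB AB.
pose a u i := u \in A i; pose b u j := u \in B j.
pose C i j := [set u | [&& a u i, b u j &
  (\sum_(l < i) a u l == \sum_(l < j) b u l)%N]].
have ab u : (\sum_(i < n) a u i = \sum_(j < m) b u j)%N.
  apply/eqP; rewrite -eqz_nat !(big_morph Posz PoszD (erefl _)); apply/eqP.
  transitivity (\sum_(i < n) \1_(A i) u : int).
    by apply: eq_bigr => i _; rewrite indicE natz.
  by rewrite AB; apply: eq_bigr => j _; rewrite indicE natz.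
exists C; split => [i j|i j u|i u lt_in|j u lt_jm].
- exact: clopen_equal_rank.
- by move=> /and3P[/set_mem ? /set_mem ? _].
- rewrite indicE; have [au|nau] := boolP (u \in A i); last first.
    rewrite big1// => j _; rewrite indicE memNset// => /and3P[au _ _].
    by case/negP: nau.
  have /(congr1 Posz) := sum_rank_eq (ab u) lt_in au.
  rewrite (big_morph Posz PoszD (erefl _)) => sum1.
  rewrite -[LHS]/(Posz 1) -sum1; apply: eq_bigr => j _.
  rewrite indicE natz; congr (Posz (nat_of_bool _)).
  apply/idP/idP => [bc|/set_mem/and3P[_ -> ->//]].
  by apply/mem_set; rewrite /C/= /a au.
- rewrite indicE; have [bu|nbu] := boolP (u \in B j); last first.
    rewrite big1// => i _; rewrite indicE memNset// => /and3P[_ bu _].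
    by case/negP: nbu.
  have /(congr1 Posz) := sum_rank_eq (esym (ab u)) lt_jm bu.
  rewrite (big_morph Posz PoszD (erefl _)) => sum1.
  rewrite -[LHS]/(Posz 1) -sum1; apply: eq_bigr => i _.
  rewrite indicE natz; congr (Posz (nat_of_bool _)).
  apply/idP/idP => [/andP[ai ac]|/set_mem/and3P[-> _ /eqP->]]; last exact: eqxx.
  by apply/mem_set; rewrite /C/= /b bu ai eq_sym.
Qed.

End Refinement.

(** * Slices *)

Section Slices.
Variables (S X Y : topologicalType) (p : S -> X) (q : S -> Y).

(** A slice of a pair of maps [p : S -> X], [q : S -> Y]: a compact open set on
which both are injective.  For the source and range maps of an etale groupoid
these are the compact open bisections. *)
Definition slice (E : set S) :=
  [/\ compact E, open E, {in E &, injective p} & {in E &, injective q}].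

(** The relation that slices induce between integer functions on X and on Y; for
the source and range of an etale groupoid it is [type_equiv].  A slice may
occur several times in the list. *)
Definition slice_equiv (f : X -> int) (g : Y -> int) :=
  exists s : seq (set S),
    [/\ forall E, E \in s -> slice E,
        forall u, f u = \sum_(E <- s) \1_(p @` E) u &
        forall v, g v = \sum_(E <- s) \1_(q @` E) v].

Lemma slice0 : slice set0.
Proof.
by split; [exact: compact0|exact: open0|..] => x y; rewrite inE.
Qed.

Lemma slice_nth s i : (forall E, E \in s -> slice E) -> slice (nth set0 s i).
Proof.
move=> sl; have [lt_is|ge_is] := ltnP i (size s); first exact/sl/mem_nth.
by rewrite nth_default//; exact: slice0.
Qed.

Lemma sliceI E F : slice E -> clopen F -> slice (E `&` F).
Proof.
move=> [cE oE pE qE] [oF cF]; split.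
- exact: compact_closedI.
- exact: openI.
- by move=> x y /set_mem[Ex _] /set_mem[Ey _]; apply: pE; exact/mem_set.
- by move=> x y /set_mem[Ex _] /set_mem[Ey _]; apply: qE; exact/mem_set.
Qed.

Lemma slice_equivD f f' g g' : slice_equiv f g -> slice_equiv f' g' ->
  slice_equiv (f \+ f') (g \+ g').
Proof.
move=> [s [sl fE gE]] [s' [sl' fE' gE']]; exists (s ++ s'); split => [E|u|v].
- by rewrite mem_cat => /orP[/sl|/sl'].
- by rewrite big_cat/= fE fE'.
- by rewrite big_cat/= gE gE'.
Qed.

End Slices.

Lemma slice_sym (S X Y : topologicalType) (p : S -> X) (q : S -> Y) E :
  slice p q E -> slice q p E.
Proof. by case. Qed.

Lemma slice_equiv_sym (S X Y : topologicalType) (p : S -> X) (q : S -> Y) f g :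
  slice_equiv p q f g -> slice_equiv q p g f.
Proof.
by move=> [s [sl fE gE]]; exists s; split=> // E /sl; exact: slice_sym.
Qed.

Lemma clopen_slice_image (S X Y : topologicalType) (p : S -> X) (q : S -> Y) E :
  hausdorff_space X -> continuous p -> open_map p -> slice p q E ->
  clopen (p @` E).
Proof.
move=> hX cp op [cE oE _ _]; split; first exact: op.
apply: compact_closed => //; apply: continuous_compact cE.
exact: continuous_subspaceT.
Qed.

(** The pieces of a slice over the parts of a partition of its image under [q]
have images under [p] that partition the image of the slice. *)
Lemma indic_image_sum (S X Y : topologicalType) (p : S -> X) (q : S -> Y)
    (E : set S) (C : nat -> set Y) m :
  {in E &, injective p} ->
  (forall v, \1_(q @` E) v = \sum_(j < m) \1_(C j) v :> int) ->
  forall u, \1_(p @` E) u =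
    \sum_(j < m) \1_(p @` (E `&` q @^-1` C j)) u :> int.
Proof.
move=> pE qC u; have [[x Ex <-]|nEu] := pselect ((p @` E) u); last first.
  rewrite indicE memNset// big1// => j _; rewrite indicE memNset//.
  by move=> [x [Ex _] xu]; apply: nEu; exists x.
have := qC (q x); rewrite !indicE mem_set; last by exists x.
rewrite mem_set; last by exists x.
move=> ->; apply: eq_bigr => j _; rewrite !indicE; congr ((nat_of_bool _)%:R).
apply/idP/idP => /set_mem => [Cj|[y [Ey /= Cj]]].
  by apply/mem_set; exists x.
by move/pE => <-; [exact/mem_set|exact/mem_set|exact/mem_set].
Qed.

(** * Composition *)

Section Composition.
Variables (S T U X Y W : topologicalType).
Variables (p1 : S -> X) (q1 : S -> Y) (p2 : T -> Y) (q2 : T -> W).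
Variables (p3 : U -> X) (q3 : U -> W).
Hypothesis hY : hausdorff_space Y.
Hypotheses (cq1 : continuous q1) (oq1 : open_map q1).
Hypotheses (cp2 : continuous p2) (op2 : open_map p2).
Hypothesis comp : forall E F, slice p1 q1 E -> slice p2 q2 F ->
  q1 @` E = p2 @` F ->
  exists M, [/\ slice p3 q3 M, p3 @` M = p1 @` E & q3 @` M = q2 @` F].

(** The given slices are cut along a common refinement of the two decompositions
of [g], and matching pieces are composed by [comp]. *)
Lemma slice_equiv_comp f g h :
  slice_equiv p1 q1 f g -> slice_equiv p2 q2 g h -> slice_equiv p3 q3 f h.
Proof.
move=> [s [sl fE gE]] [t [tl gF hF]].
pose E := nth set0 s; pose F := nth set0 t.
have sE i : slice p1 q1 (E i) by exact: slice_nth.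
have sF j : slice p2 q2 (F j) by exact: slice_nth.
have [||v|C [clC CEF CE CF]] := @equal_sum_refinement Y
    (fun i => q1 @` E i) (fun j => p2 @` F j) (size s) (size t).
- by move=> i; apply: clopen_slice_image (slice_sym (sE i)).
- by move=> j; apply: clopen_slice_image (sF j).
- by rewrite -(big_mkord xpredT (fun i => \1_(q1 @` E i) v))
    -(big_mkord xpredT (fun j => \1_(p2 @` F j) v))
    -(big_nth set0 xpredT (fun E => \1_(q1 @` E) v))
    -(big_nth set0 xpredT (fun E => \1_(p2 @` E) v)) -gE -gF.
pose E' i j := E i `&` q1 @^-1` C i j; pose F' i j := F j `&` p2 @^-1` C i j.
have /choice[M MP] (k : nat * nat) : exists M,
    [/\ slice p3 q3 M, p3 @` M = p1 @` E' k.1 k.2 & q3 @` M = q2 @` F' k.1 k.2].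
  case: k => i j /=; apply: comp.
  - by apply: sliceI => //; exact: preimage_clopen.
  - by apply: sliceI => //; exact: preimage_clopen.
  have sub v : C i j v -> _ := @CEF i j v.
  apply/seteqP; split => [_ [x [Ex /= Cx] <-]|_ [y [Fy /= Cy] <-]].
    by have [_ [y Fy yx]] := sub _ Cx; exists y => //;
      split=> //=; rewrite yx.
  by have [[x Ex xy] _] := sub _ Cy; exists x => //;
    split=> //=; rewrite xy.
exists [seq M (i, j) | i <- index_iota 0 (size s), j <- index_iota 0 (size t)].
split => [_ /allpairsP[[i j] [_ _ ->]]|u|w]; first by have [] := MP (i, j).
- rewrite fE big_allpairs_dep/= (big_nth set0) !big_mkord.
  apply: eq_bigr => i _; rewrite big_mkord.
  have [_ _ inj1 _] := sE i.
  rewrite (indic_image_sum inj1 (CE i ^~ (ltn_ord i))).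
  by apply: eq_bigr => j _; have [_ -> _] := MP (i : nat, j : nat).
- rewrite hF big_allpairs_dep/= exchange_big/= (big_nth set0) !big_mkord.
  apply: eq_bigr => j _; rewrite big_mkord.
  have [_ _ _ inj2] := sF j.
  rewrite (indic_image_sum (C := C ^~ j) inj2 (CF j ^~ (ltn_ord j))).
  by apply: eq_bigr => i _; have [_ _ ->] := MP (i : nat, j : nat).
Qed.

End Composition.

(** * Free and proper actions *)

Lemma closed_eq_setX (X Y U : topologicalType) (f : X -> U) (h : Y -> U) :
  hausdorff_space U -> continuous f -> continuous h ->
  closed [set p : X * Y | f p.1 = h p.2].
Proof.
move=> hU cf ch; rewrite -openC openE => -[x y] /= fxhy.
have : ~ cluster (nbhs (f x)) (h y) by move=> /hU.
move=> /existsNP[A] /existsNP[B] /not_implyP[Ax] /not_implyP[By AB0].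
exists (f @^-1` A, h @^-1` B) => /=; first by split; [exact: cf|exact: ch].
move=> -[x' y'] /= [Ax' By'] e; apply: AB0.
by exists (f x'); split=> //; rewrite e.
Qed.

Lemma hausdorff_setX (X Y : topologicalType) :
  hausdorff_space X -> hausdorff_space Y -> hausdorff_space (X * Y)%type.
Proof.
move=> hX hY [x y] [x' y'] cl; congr pair.
  apply: hX => A B Ax Bx'.
  have [||[u v] [[/= Au _] [/= Bu _]]] := cl (A `*` setT) (B `*` setT).
  - by exists (A, setT) => //; split=> //=; exact: filterT.
  - by exists (B, setT) => //; split=> //=; exact: filterT.
  - by exists u.
apply: hY => A B Ay By'.
have [||[u v] [[/= _ Av] [/= _ Bv]]] := cl (setT `*` A) (setT `*` B).
- by exists (setT, A) => //; split=> //=; exact: filterT.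
- by exists (setT, B) => //; split=> //=; exact: filterT.
- by exists v.
Qed.

Lemma open_units (G : groupoid) : etale G -> open (range (@gunit G)).
Proof.
move=> eG; rewrite openE => _ [u _ <-]; rewrite /interior.
have [V [oV Vu _ [_ [g [_ gK]]]]] := eG.2 (gunit u).
have nV : nbhs (gunit u) V by exact: open_nbhs_nbhs.
have nsV : nbhs (gsource (gunit u)) (@gunit G @^-1` V).
  by rewrite gsource_unit; exact: continuous_gunit.
apply: filterS2 nV (continuous_gsource nsV) => x Vx /= Vsx.
exists (gsource x) => //.
by apply: (can_in_inj gK); rewrite ?inE// gsource_unit.
Qed.

Section Principal.
Variables (G : groupoid) (Z V : topologicalType).
Variables (L : left_action G Z) (sigma : Z -> V).

(** A free and proper left action of G on a locally compact Hausdorff space Z,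
with open anchor map, together with a continuous open map [sigma] on Z whose
fibres are exactly the orbits. *)
Record principal_action : Prop := PrincipalAction {
  principal_hausdorff : hausdorff_space Z;
  principal_locally_compact : locally_compact [set: Z];
  principal_free : free_left_action L;
  principal_proper : proper_left_action L;
  principal_open_anchor : open_map (lanchor L);
  principal_continuous : continuous sigma;
  principal_open : open_map sigma;
  principal_orbit : forall z z', sigma z = sigma z' <->
    exists2 g, gsource g = lanchor L z & lact L g z = z'
}.

Hypotheses (eG : etale G) (PL : principal_action).

(** Continuity of the action, for an open target and with the neighbourhood
taken to be a product. *)
Lemma lact_near (B : set Z) g z : gsource g = lanchor L z ->
  open B -> B (lact L g z) ->
  exists P : set G * set Z, [/\ nbhs g P.1, nbhs z P.2 &
    forall g' z', P.1 g' -> P.2 z' -> gsource g' = lanchor L z' ->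
      B (lact L g' z')].
Proof.
move=> gz oB Bgz; have /within_continuousP cL := @continuous_lact _ _ L.
have [P [P1 P2] subP] := cL (g, z) B gz (open_nbhs_nbhs (conj oB Bgz)).
by exists P; split=> // g' z' P1g P2z gz'; exact: (subP (g', z')).
Qed.

Lemma lact_invl g z : gsource g = lanchor L z ->
  lact L (ginv g) (lact L g z) = z.
Proof. by move=> gz; rewrite -lactM ?gsource_inv// gmulVg gz lact1. Qed.

Lemma lact_inj g h z : gsource g = lanchor L z -> gsource h = lanchor L z ->
  lact L g z = lact L h z -> g = h.
Proof.
move=> gz hz ghz; have rgh : grange g = grange h.
  by rewrite -(lanchor_act gz) -(lanchor_act hz) ghz.
have sV : gsource (ginv h) = grange g by rewrite gsource_inv.
have : gmul (ginv h) g = gunit (lanchor L z).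
  apply: (principal_free PL); first by rewrite gsource_mul.
  by rewrite lactM// ghz lact_invl.
move=> /(congr1 (gmul h)); rewrite -hz gmulg1 gmulA// ?grange_inv//.
by rewrite gmulgV -rgh gmul1g.
Qed.

Lemma principal_act g z : gsource g = lanchor L z ->
  sigma (lact L g z) = sigma z.
Proof. by move=> gz; apply/esym/(principal_orbit PL); exists g. Qed.

(** For a compact neighbourhood K of z, the set C of the pairs (g, x) such that
g is not a unit and both x and g x are in K is compact, by properness and
because the units are open.  By freeness (z, z) is not in its image D under
(g, x) |-> (g x, x), so a neighbourhood of z contains no two distinct points of
the same orbit. *)
Lemma principal_locally_injective z :
  exists U, [/\ open U, U z & {in U &, injective sigma}].
Proof.
have hZZ := hausdorff_setX (principal_hausdorff PL) (principal_hausdorff PL).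
have [K zK [cK _]] :
  exists2 K, within [set: Z] (nbhs z) K & compact K /\ closed K.
  exact: (principal_locally_compact PL).
have {}zK : nbhs z K.
  by move: zK; rewrite /within/=; apply: filterS => x; apply.
pose C := [set p : G * Z | gsource p.1 = lanchor L p.2 /\
  (K `*` K) (lact L p.1 p.2, p.2)] `&` [set p | ~ range (@gunit G) p.1].
have cC : compact C.
  apply: compact_closedI.
    by apply: (principal_proper PL); exact: compact_setX.
  apply: (@preimage_closed _ _ fst (~` range (@gunit G))).
    by move=> p _; exact: cvg_fst.
  by apply: open_closedC; exact: open_units.
pose D := (fun p : G * Z => (lact L p.1 p.2, p.2)) @` C.
have cD : closed D.
  apply: compact_closed => //; apply: continuous_compact cC.
  apply/within_continuousP => -[g w] W [[/= gw _] _] [[P Q] /= [nP nQ] PQ].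
  have /within_continuousP cL := @continuous_lact _ _ L.
  have nQ' : nbhs (g, w) (snd @^-1` Q) by exact: cvg_snd nQ.
  apply: filterS2 (cL (g, w) P gw nP) nQ' => p Pp Qp [[pP _] _].
  by apply: PQ; split=> //=; exact: Pp.
have nD : nbhs (z, z) (~` D).
  apply: open_nbhs_nbhs; split; first exact: closed_openC.
  move=> [[g w] [[/= gw _] nu] [gz wz]]; apply: nu.
  rewrite wz in gw gz; exists (lanchor L z) => //.
  by rewrite (principal_free PL gw gz).
have [[P Q] /= [nP nQ] PQ] := nD.
have : nbhs z (P `&` Q `&` K) by apply: filterI => //; exact: filterI.
rewrite nbhsE => -[U [oU Uz] UPQK]; exists U; split=> //.
move=> x y /set_mem Ux /set_mem Uy /(principal_orbit PL)[g gx gy].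
have [[_ Qx] Kx] := UPQK _ Ux; have [[Py _] Ky] := UPQK _ Uy.
have [[u _ ug]|nu] := pselect (range (@gunit G) g).
  by rewrite -gy -ug -(gsource_unit u) ug gx lact1.
case: (PQ (y, x)) => //=; exists (g, x) => /=; last by rewrite gy.
by split=> //; split=> //; rewrite /= gy.
Qed.

(** The product E.B of a bisection and a slice is a slice. *)
Lemma slice_mul E B : slice (@grange G) (@gsource G) E ->
  slice (lanchor L) sigma B -> @gsource G @` E = lanchor L @` B ->
  exists M, [/\ slice (lanchor L) sigma M, lanchor L @` M = @grange G @` E &
                sigma @` M = sigma @` B].
Proof.
move=> [cE oE rE sE] [cB oB pB sB] EB.
pose M := (fun p : G * Z => lact L p.1 p.2) @`
  ((E `*` B) `&` [set p | gsource p.1 = lanchor L p.2]).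
have MP m : M m -> exists g z,
    [/\ E g, B z, gsource g = lanchor L z & m = lact L g z].
  by move=> [[g z] [[/= Eg Bz] gz] <-]; exists g, z.
have MI g z : E g -> B z -> gsource g = lanchor L z -> M (lact L g z).
  by move=> Eg Bz gz; exists (g, z).
exists M; split.
- split.
  + apply: continuous_compact.
      by apply: continuous_subspaceW (@continuous_lact _ _ L) => p [].
    apply: compact_closedI; first exact: compact_setX.
    apply: closed_eq_setX; first exact: unit_space_hausdorff.
      exact: continuous_gsource.
    exact: continuous_lanchor.
  + rewrite openE => _ /MP[g [z [Eg Bz gz ->]]]; rewrite /interior.
    (* A point y near g z is h (h^-1 y), where h in E is close to g and its
       range is the anchor of y; then h^-1 y is close to z, hence in B. *)
    have gVz : gsource (ginv g) = lanchor L (lact L g z).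
      by rewrite gsource_inv lanchor_act.
    have [|[P Q] /= [nP nQ PQ]] := @lact_near B _ _ gVz oB.
      by rewrite lact_invl.
    have nE : nbhs g (E `&` @ginv G @^-1` P).
      by apply: filterI; [exact: open_nbhs_nbhs|exact: continuous_ginv].
    move: nE; rewrite nbhsE => -[U [oU Ug] UEP].
    have nU : nbhs (lanchor L (lact L g z)) (@grange G @` U).
      apply: open_nbhs_nbhs; split; first exact: (local_homeo_open_map eG.1).
      by rewrite lanchor_act//; exists g.
    apply: filterS2 nQ (continuous_lanchor nU) => y Qy [h Uh hy].
    have [Eh Ph] := UEP _ Uh.
    have hVy : gsource (ginv h) = lanchor L y by rewrite gsource_inv.
    have <- : lact L h (lact L (ginv h) y) = y.
      by rewrite -{1}(ginvK h) lact_invl.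
    apply: MI => //; first exact: PQ.
    by rewrite lanchor_act// grange_inv.
  + move=> _ y /set_mem/MP[g [z [Eg Bz gz ->]]].
    move=> /set_mem/MP[h [w [Eh Bw hw ->]]].
    rewrite !lanchor_act// => /rE gh.
    have {}gh : g = h by apply: gh; exact/mem_set.
    congr lact => //; apply: pB; rewrite ?inE//.
    by rewrite -gz -hw gh.
  + move=> _ y /set_mem/MP[g [z [Eg Bz gz ->]]].
    move=> /set_mem/MP[h [w [Eh Bw hw ->]]].
    rewrite !principal_act// => /sB zw.
    have {}zw : z = w by apply: zw; exact/mem_set.
    congr lact => //; apply: sE; rewrite ?inE//.
    by rewrite gz hw zw.
- apply/seteqP; split=> [_ [_ /MP[g [z [Eg Bz gz ->]]] <-]|_ [g Eg <-]].
    by rewrite lanchor_act//; exists g.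
  have : (@gsource G @` E) (gsource g) by exists g.
  rewrite EB => -[z Bz zg]; exists (lact L g z); first exact: MI.
  by rewrite lanchor_act.
- apply/seteqP; split=> [_ [_ /MP[g [z [Eg Bz gz ->]]] <-]|_ [z Bz <-]].
    by rewrite principal_act//; exists z.
  have : (lanchor L @` B) (lanchor L z) by exists z.
  rewrite -EB => -[g Eg gz]; exists (lact L g z); first exact: MI.
  by rewrite principal_act.
Qed.

(** The quotient of two slices with the same image in V: the arrows that carry a
point of B to a point of B'. *)
Lemma slice_div B B' : slice (lanchor L) sigma B ->
  slice sigma (lanchor L) B' -> sigma @` B = sigma @` B' ->
  exists M, [/\ slice (@gsource G) (@grange G) M,
                @gsource G @` M = lanchor L @` B &
                @grange G @` M = lanchor L @` B'].
Proof.
move=> [cB oB pB sB] [cB' oB' sB' pB'] BB'.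
pose M := [set g |
  exists z, [/\ B z, gsource g = lanchor L z & B' (lact L g z)]].
exists M; split.
- split.
  + have -> : M = fst @` [set p : G * Z | gsource p.1 = lanchor L p.2 /\
        (B' `*` B) (lact L p.1 p.2, p.2)].
      apply/seteqP; split=> [g [z [Bz gz B'z]]|].
        by exists (g, z).
      move=> _ [[g z] [/= gz [/= B'z Bz]] <-].
      by exists z.
    apply: continuous_compact.
      by apply: continuous_subspaceT => p; exact: cvg_fst.
    by apply: (principal_proper PL); exact: compact_setX.
  + rewrite openE => g [z [Bz gz B'z]]; rewrite /interior.
    have [[P Q] /= [nP nQ PQ]] := lact_near gz oB' B'z.
    have : nbhs z (B `&` Q) by apply: filterI => //; exact: open_nbhs_nbhs.
    rewrite nbhsE => -[U [oU Uz] UBQ].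
    have nU : nbhs (gsource g) (lanchor L @` U).
      apply: open_nbhs_nbhs; split; first exact: (principal_open_anchor PL).
      by rewrite gz; exists z.
    apply: filterS2 nP (continuous_gsource nU) => h Ph [w Uw wh].
    by have [Bw Qw] := UBQ _ Uw; exists w; split=> //; exact: PQ.
  + move=> g h /set_mem[z [Bz gz B'z]] /set_mem[w [Bw hw B'w]] gh.
    have zw : z = w by apply: pB; rewrite ?inE// -gz -hw.
    rewrite -zw in hw B'w; apply: (lact_inj gz hw).
    by apply: sB'; rewrite ?inE// !principal_act.
  + move=> g h /set_mem[z [Bz gz B'z]] /set_mem[w [Bw hw B'w]] gh.
    have gzhw : lact L g z = lact L h w.
      by apply: pB'; rewrite ?inE// !lanchor_act.
    have zw : z = w.
      by apply: sB; rewrite ?inE// -(principal_act gz) gzhw principal_act.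
    by rewrite -zw in hw gzhw; exact: lact_inj gzhw.
- apply/seteqP; split=> [_ [g [z [Bz gz _]] <-]|_ [z Bz <-]].
    by rewrite gz; exists z.
  have : (sigma @` B) (sigma z) by exists z.
  rewrite BB' => -[z' B'z' /esym/(principal_orbit PL)[g gz gzz']].
  by exists g => //; exists z; rewrite gzz'.
- apply/seteqP; split=> [_ [g [z [_ gz B'z]] <-]|_ [z' B'z' <-]].
    by exists (lact L g z); rewrite ?lanchor_act.
  have : (sigma @` B') (sigma z') by exists z'.
  rewrite -BB' => -[z Bz /(principal_orbit PL)[g gz gzz']].
  exists g; first by exists z; rewrite gzz'.
  by rewrite -gzz' lanchor_act.
Qed.

End Principal.

(** * Reversing a right action *)

Lemma ginv_unit (G : groupoid) u : ginv (@gunit G u) = gunit u.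
Proof.
have := gmulVg (@gunit G u); rewrite gsource_unit => {2}<-.
by rewrite -{3}(grange_unit u) -gsource_inv gmulg1.
Qed.

Lemma ginvM (G : groupoid) (x y : G) : gsource x = grange y ->
  ginv (gmul x y) = gmul (ginv y) (ginv x).
Proof.
move=> xy; have rV : gsource (ginv y) = grange (ginv x).
  by rewrite gsource_inv grange_inv.
have sV : gsource (gmul (ginv y) (ginv x)) = grange (gmul x y).
  by rewrite gsource_mul// gsource_inv grange_mul.
have e : gmul (gmul (ginv y) (ginv x)) (gmul x y) = gunit (gsource y).
  rewrite -gmulA ?gsource_inv ?grange_mul//; last by rewrite grange_inv.
  rewrite (gmulA (x := ginv x)) ?gsource_inv// gmulVg xy gmul1g.
  by rewrite gmulVg.
rewrite -[RHS]gmulg1 sV -gmulgV gmulA// ?grange_inv// e.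
by rewrite -(gsource_mul xy) -grange_inv gmul1g.
Qed.

Section ReverseAction.
Variables (H : groupoid) (Z : topologicalType) (R : right_action H Z).

Let rev_act (h : H) (z : Z) := ract R z (ginv h).

Fact rev_anchor_act h z : gsource h = ranchor R z ->
  ranchor R (rev_act h z) = grange h.
Proof. by move=> hz; rewrite ranchor_act ?gsource_inv ?grange_inv. Qed.

Fact rev_act1 z : rev_act (gunit (ranchor R z)) z = z.
Proof. by rewrite /rev_act ginv_unit ract1. Qed.

Fact rev_actM g h z : gsource g = grange h -> gsource h = ranchor R z ->
  rev_act (gmul g h) z = rev_act g (rev_act h z).
Proof.
move=> gh hz; rewrite /rev_act ginvM// ractM ?grange_inv//.
by rewrite gsource_inv.
Qed.

Fact continuous_rev_act :
  {within [set p : H * Z | gsource p.1 = ranchor R p.2],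
    continuous (fun p : H * Z => rev_act p.1 p.2)}.
Proof.
apply/within_continuousP => -[h z] W /= hz nW.
have /within_continuousP cR := @continuous_ract _ _ R.
have zh : ranchor R z = grange (ginv h) by rewrite grange_inv.
have [[P Q] /= [nP nQ] PQ] := cR (z, ginv h) W zh nW.
exists (@ginv H @^-1` Q, P) => /=; first by split=> //; exact: continuous_ginv.
move=> [h' z'] /= [Qh' Pz'] hz'.
by apply: (PQ (z', ginv h')) => //=; rewrite grange_inv.
Qed.

(** The left action h.z = z h^-1 of H associated with a right action. *)
Definition rev_action : left_action H Z :=
  LeftAction rev_anchor_act rev_act1 rev_actM (@continuous_ranchor _ _ R)
    continuous_rev_act.

Lemma free_rev_action : free_right_action R -> free_left_action rev_action.
Proof.
move=> fR h z hz /fR hK; rewrite -(ginvK h) hK ?grange_inv//.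
by rewrite ginv_unit.
Qed.

Lemma proper_rev_action :
  proper_right_action R -> proper_left_action rev_action.
Proof.
move=> pR K cK.
have cK' : compact ((fun p : Z * Z => (p.2, p.1)) @` K).
  apply: continuous_compact cK; apply: continuous_subspaceT => p.
  by apply: cvg_pair; [exact: cvg_snd|exact: cvg_fst].
have -> : [set p : H * Z | gsource p.1 = lanchor rev_action p.2 /\
      K (lact rev_action p.1 p.2, p.2)] =
    (fun p : Z * H => (ginv p.2, p.1)) @`
      [set p | ranchor R p.1 = grange p.2 /\
        ((fun p : Z * Z => (p.2, p.1)) @` K) (p.1, ract R p.1 p.2)].
  apply/seteqP; split=> [[h z] /= [hz Kz]|].
    exists (z, ginv h) => /=; last by rewrite ginvK.
    by split; [rewrite grange_inv|exists (rev_act h z, z)].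
  move=> _ [[z h] /= [zh [[y w] Kyw [yz wz]]] <-] /=; rewrite gsource_inv.
  by split=> //; rewrite /rev_act ginvK -wz -yz.
apply: continuous_compact (pR _ cK'); apply: continuous_subspaceT => p.
apply: cvg_pair; last exact: cvg_fst.
by apply: continuous_comp; [exact: cvg_snd|exact: continuous_ginv].
Qed.

Lemma rev_action_orbit z z' : right_orbit R z z' <->
  exists2 h, gsource h = lanchor rev_action z & lact rev_action h z = z'.
Proof.
split=> [/asboolP[h zh <-]|[h hz <-]].
  by exists (ginv h); rewrite /= ?gsource_inv// /rev_act ginvK.
by apply/asboolP; exists (ginv h); rewrite // grange_inv.
Qed.

End ReverseAction.

(** * Both actions of an equivalence are principal *)

Section Equivalence.
Variables (G H : groupoid) (Z : topologicalType).
Variables (L : left_action G Z) (R : right_action H Z).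
Hypothesis eqLR : is_equivalence L R.

Lemma equivalence_principal_left : principal_action L (ranchor R).
Proof.
split.
- exact: equivalence_hausdorff eqLR.
- exact: equivalence_locally_compact eqLR.
- exact: equivalence_free_left eqLR.
- exact: equivalence_proper_left eqLR.
- exact: equivalence_open_left eqLR.
- exact: continuous_ranchor.
- exact: equivalence_open_right eqLR.
- move=> z z'.
  have [F [[_ [F' [_ FK _]]] FE]] := equivalence_quotient_left eqLR.
  rewrite -!FE; split=> [/(can_inj FK)/eqmodP/asboolP//|zz'].
  by congr F; apply/eqmodP/asboolP.
Qed.

Lemma equivalence_principal_right :
  principal_action (rev_action R) (lanchor L).
Proof.
split.
- exact: equivalence_hausdorff eqLR.
- exact: equivalence_locally_compact eqLR.
- exact/free_rev_action/(equivalence_free_right eqLR).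
- exact/proper_rev_action/(equivalence_proper_right eqLR).
- exact: equivalence_open_right eqLR.
- exact: continuous_lanchor.
- exact: equivalence_open_left eqLR.
- move=> z z'.
  have [F [[_ [F' [_ FK _]]] FE]] := equivalence_quotient_right eqLR.
  rewrite -rev_action_orbit -!FE; split=> [/(can_inj FK)/eqmodP//|zz'].
  by congr F; exact/eqmodP.
Qed.

End Equivalence.

(** * Existence of slices *)

Lemma compact_open_nbhd (G : ample_groupoid) (u : unit_space G) W :
  open W -> W u -> exists A, [/\ compact A, open A, A u & A `<=` W].
Proof.
move=> oW Wu; have [_ bG] := @ample_ample G.
have nW : nbhs (gunit u) (@gsource G @^-1` W).
  apply: continuous_gsource; rewrite gsource_unit.
  exact: open_nbhs_nbhs.
have [E [[cE [_ _ oE _ _]] Eu] EW] := bG _ _ nW.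
exists (@gsource G @` E); split=> //.
- apply: continuous_compact cE; apply: continuous_subspaceT.
  exact: continuous_gsource.
- by exists (gunit u); rewrite ?gsource_unit.
- by move=> _ [x Ex <-]; exact: EW.
Qed.

(** In an open set on which both maps are injective, slices are found by lifting
compact open sets of units along [p]. *)
Lemma slice_nbhd (G : ample_groupoid) (Z V : topologicalType)
    (p : Z -> unit_space G) (q : Z -> V) z U :
  continuous p -> open_map p -> open U -> U z ->
  {in U &, injective p} -> {in U &, injective q} ->
  exists2 B, slice p q B & B z.
Proof.
move=> cp op oU Uz pU qU.
have [_ [g [cg gK]]] := open_map_homeo_on (fun=> z) cp op oU pU.
have [A [cA oA Az AU]] := compact_open_nbhd (op _ oU) (imageP p Uz).
have BE : g @` A = U `&` p @^-1` A.
  apply/seteqP; split=> [_ [u Au <-]|x [Ux Ax]].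
    by have [x Ux xu] := AU _ Au; rewrite -xu gK ?inE//; split; rewrite //= xu.
  by exists (p x); rewrite // gK ?inE.
exists (U `&` p @^-1` A); last by split.
split.
- by rewrite -BE; apply: continuous_compact cA; exact: continuous_subspaceW cg.
- by apply: openI => //; move/continuousP : cp; exact.
- by move=> x y /set_mem[Ux _] /set_mem[Uy _]; apply: pU; exact/mem_set.
- by move=> x y /set_mem[Ux _] /set_mem[Uy _]; apply: qU; exact/mem_set.
Qed.

Lemma Cc_pos_indic (X : topologicalType) (A : set X) :
  hausdorff_space X -> compact A -> open A ->
  exists f : Cc_pos X, forall u, f u = \1_A u.
Proof.
move=> hX cA oA; have clA : clopen A by split=> //; exact: compact_closed.
suff A1 : Cc_pos_pred (\1_A : X -> int) by exists (CcPos A1).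
apply/asboolP; split=> [||u]; last by rewrite indicE; case: (u \in A).
  apply/continuous_discreteP => u.
  apply: filterS ((clopen_locally_constant A).1 clA u) => v.
  by rewrite !indicE => ->.
rewrite (_ : [set u | _] = A).
  by rewrite -(closure_id A).1//; exact: compact_closed.
apply/seteqP; split=> u /=; rewrite indicE.
  by case: (boolP (u \in A)) => [/set_mem//|]; rewrite eqxx.
by move=> Au; rewrite mem_set.
Qed.

(** * Totality of the relation induced by slices *)

Section Totality.
Variables (G : ample_groupoid) (S Y : topologicalType).
Variables (p : S -> unit_space G) (q : S -> Y).
Hypothesis hY : hausdorff_space Y.
Hypotheses (cp : continuous p) (op : open_map p).
Hypotheses (cq : continuous q) (oq : open_map q).
Hypothesis through : forall u, exists2 B, slice p q B & (p @` B) u.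

(** [f] is a finite sum of indicators of images of slices. *)
Let decomposes (f : unit_space G -> int) := exists s : seq (set S),
  (forall E, E \in s -> slice p q E) /\
  forall u, f u = \sum_(E <- s) \1_(p @` E) u.

Lemma compact_slice_cover (A : set (unit_space G)) : compact A ->
  exists s : seq (set S), (forall E, E \in s -> slice p q E) /\
    forall u, A u -> exists2 E, E \in s & (p @` E) u.
Proof.
move=> /compact_near_coveringP nA.
(* Near-covering compactness along the filter of large lists of slices. *)
pose slices (s : seq (set S)) := forall E, E \in s -> slice p q E.
pose F := filter_from slices (fun s => [set t : seq (set S) | {subset s <= t}]).
have FF : Filter F.
  apply: filter_from_filter; first by exists [::].
  move=> s t sl tl; exists (s ++ t).
    by move=> E; rewrite mem_cat => /orP[/sl|/tl].
  by move=> r str; split=> E Es; apply: str; rewrite mem_cat Es ?orbT.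
pose covered (s : seq (set S)) u := exists2 E, E \in s & (p @` E) u.
have [u Au|s sl sA] := nA _ F covered FF.
  have [B sB Bu] := through u.
  exists (p @` B, [set t : seq (set S) | {subset [:: B] <= t}]) => /=.
    split; first by apply: open_nbhs_nbhs; split=> //; case: sB => _ /op.
    by exists [:: B] => // E; rewrite inE => /eqP->.
  by move=> [v t] /= [Bv Bt]; exists B => //; apply: Bt; rewrite inE.
by exists s; split=> // u; exact: sA.
Qed.

(** The images of the slices in the list are made disjoint one by one. *)
Lemma decomposes_clopen (s : seq (set S)) A :
  (forall E, E \in s -> slice p q E) ->
  clopen A -> (forall u, A u -> exists2 E, E \in s & (p @` E) u) ->
  decomposes \1_A.
Proof.
elim: s A => [|E s IHs] A sl clA As.
  by exists [::]; split=> // u; rewrite big_nil indicE memNset// => /As[].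
have sE : slice p q E by apply: sl; rewrite inE eqxx.
have clE : clopen (p @` E).
  exact: clopen_slice_image (@unit_space_hausdorff G) cp op sE.
have clAE : clopen (A `\` p @` E).
  by rewrite setDE; apply: clopenI => //; exact: clopenC.
have [F Fs|u [/As[F + Fu] nEu]|t [tl tE]] := IHs _ _ clAE.
- by apply: sl; rewrite inE Fs orbT.
- by rewrite inE => /orP[/eqP FE|Fs]; [rewrite FE in Fu|exists F].
exists (E `&` p @^-1` A :: t); split=> [F|u].
  rewrite inE => /orP[/eqP->|/tl//].
  by apply: sliceI => //; exact: preimage_clopen.
rewrite big_cons -tE !indicE in_setD.
have -> : (u \in p @` (E `&` p @^-1` A)) = (u \in A) && (u \in p @` E).
  apply/idP/andP => [/set_mem[x [Ex Ax] <-]|[/set_mem Au /set_mem[x Ex xu]]].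
    by split; apply/mem_set => //; exists x.
  by apply/mem_set; exists x => //; split; rewrite //= xu.
by case: (u \in A); case: (u \in p @` E); rewrite /= ?addr0 ?add0r.
Qed.

(** Reflexivity of the type equivalence writes [f] as a sum of indicators of
compact open sets. *)
Lemma decomposes_Cc_pos (f : Cc_pos (unit_space G)) : decomposes f.
Proof.
have [n [E [bE fE _]]] := type_equiv_refl (@ample_etale G) f.
have {fE} -> : f =
    (fun u => \sum_(i < n) \1_(@gsource G @` E i) u) :> (_ -> int).
  exact/funext.
elim: (index_enum _) => [|i r [t [tl tE]]].
  by exists [::]; split=> // u; rewrite !big_nil.
have [cE [_ _ oE _ _]] := bE i.
have cA : compact (@gsource G @` E i).
  apply: continuous_compact cE.
  exact/continuous_subspaceT/continuous_gsource.
have [s [sl sA]] := compact_slice_cover cA.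
have [s' [sl' sE']] := decomposes_clopen sl (clopen_bisection_source (bE i)) sA.
exists (s' ++ t); split=> [F|u]; last by rewrite big_cons big_cat/= tE sE'.
by rewrite mem_cat => /orP[/sl'|/tl].
Qed.

Lemma slice_equiv_total (f : Cc_pos (unit_space G)) :
  exists h : Cc_pos Y, slice_equiv p q f h.
Proof.
have [s [sl fE]] := decomposes_Cc_pos f.
suff [h hE] : exists h : Cc_pos Y, forall v, h v = \sum_(E <- s) \1_(q @` E) v.
  by exists h, s.
elim: s sl {fE} => [|E s IHs] sl; first by exists 0 => v; rewrite big_nil.
have [|h hE] := IHs.
  by move=> F Fs; apply: sl; rewrite inE Fs orbT.
have [cE oE _ _] : slice p q E by apply: sl; rewrite inE eqxx.
have [||k kE] := @Cc_pos_indic Y (q @` E) hY.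
- by apply: continuous_compact cE; exact: continuous_subspaceT.
- exact: oq.
by exists (k + h) => v; rewrite big_cons -kE -hE.
Qed.

End Totality.

(** * Comparison with the type equivalence *)

Lemma type_equivP (G : groupoid) (f g : Cc_pos (unit_space G)) : etale G ->
  type_equiv f g <-> slice_equiv (@gsource G) (@grange G) f g.
Proof.
move=> eG.
have slP E : compact_open_bisection E <-> slice (@gsource G) (@grange G) E.
  split=> [/(compact_open_bisectionP _ eG)[]//|[]].
  by move=> *; apply/compact_open_bisectionP.
split=> [[n [E [bE fE gE]]]|[s [sl fE gE]]].
  exists [seq E i | i : 'I_n]; split=> [_ /mapP[i _ ->]|u|u].
  - exact/slP.
  - by rewrite fE big_map big_enum.
  - by rewrite gE big_map big_enum.
exists (size s), (fun i => nth set0 s i); split=> [i|u|u].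
- by apply/slP/sl/mem_nth.
- by rewrite fE (big_nth set0) big_mkord.
- by rewrite gE (big_nth set0) big_mkord.
Qed.

Section PrincipalTypeEquiv.
Variables (G : groupoid) (Z V : topologicalType).
Variables (L : left_action G Z) (sigma : Z -> V).
Hypotheses (eG : etale G) (hV : hausdorff_space V).
Hypothesis PL : principal_action L sigma.
Implicit Types (f : Cc_pos (unit_space G)) (h : V -> int).

(** The functions related to a given [h] are closed under type equivalence
([type_equiv_act]) and are all type equivalent ([type_equiv_div]): they form at
most one class. *)
Lemma type_equiv_act f f' h : type_equiv f f' ->
  slice_equiv (lanchor L) sigma f h -> slice_equiv (lanchor L) sigma f' h.
Proof.
move=> /(type_equivP _ _ eG)/slice_equiv_sym.
apply: slice_equiv_comp.
- exact: unit_space_hausdorff.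
- exact: continuous_gsource.
- exact: local_homeo_open_map eG.2.
- exact: continuous_lanchor.
- exact: principal_open_anchor PL.
- exact: slice_mul.
Qed.

Lemma type_equiv_div f f' h : slice_equiv (lanchor L) sigma f h ->
  slice_equiv (lanchor L) sigma f' h -> type_equiv f f'.
Proof.
move=> fh /slice_equiv_sym f'h; apply/type_equivP => //.
apply: slice_equiv_comp fh f'h => //.
- exact: principal_continuous PL.
- exact: principal_open PL.
- exact: principal_continuous PL.
- exact: principal_open PL.
- exact: slice_div.
Qed.

End PrincipalTypeEquiv.

(** * The isomorphism *)

Theorem corollary5p8 (G H : ample_groupoid) :
  sigma_compact (unit_space G) -> sigma_compact (unit_space H) ->
  groupoid_equivalent G H ->
  exists phi : {additive type_semigroup G -> type_semigroup H}, bijective phi.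
Proof.
move=> _ _ [Z [L [R eqLR]]].
have eG := @ample_etale G; have eH := @ample_etale H.
have hG := @unit_space_hausdorff G; have hH := @unit_space_hausdorff H.
have PL := equivalence_principal_left eqLR.
have PR := equivalence_principal_right eqLR.
have [cl ol] := (@continuous_lanchor _ _ L, equivalence_open_left eqLR).
have [cr orr] := (@continuous_ranchor _ _ R, equivalence_open_right eqLR).
have loc z : exists U, [/\ open U, U z, {in U &, injective (lanchor L)} &
    {in U &, injective (ranchor R)}].
  have [U [oU Uz rU]] := principal_locally_injective eG PL z.
  have [U' [oU' Uz' lU']] := principal_locally_injective eH PR z.
  exists (U `&` U'); split; [exact: openI|by []|..].
    by move=> x y /set_mem[_ Ux] /set_mem[_ Uy]; apply: lU'; exact/mem_set.
  by move=> x y /set_mem[Ux _] /set_mem[Uy _]; apply: rU; exact/mem_set.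
pose rel f h := slice_equiv (lanchor L) (ranchor R) f h.
have totG (f : Cc_pos (unit_space G)) : exists h : Cc_pos _, rel f h.
  apply: slice_equiv_total => // u.
  have [z zu] := equivalence_surj_left eqLR u.
  have [U [oU Uz lU rU]] := loc z.
  by have [B sB Bz] := slice_nbhd cl ol oU Uz lU rU; exists B => //; exists z.
have totH (h : Cc_pos (unit_space H)) : exists f : Cc_pos _, rel f h.
  suff [f hf] : exists f : Cc_pos _, slice_equiv (ranchor R) (lanchor L) h f.
    by exists f; exact: slice_equiv_sym.
  apply: slice_equiv_total => // v.
  have [z zv] := equivalence_surj_right eqLR v.
  have [U [oU Uz lU rU]] := loc z.
  by have [B sB Bz] := slice_nbhd cr orr oU Uz rU lU; exists B => //; exists z.
have actH f h h' : type_equiv h h' -> rel f h -> rel f h'.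
  move=> hh' /slice_equiv_sym fh; apply: slice_equiv_sym.
  exact: (type_equiv_act eH PR hh').
have divH f (h h' : Cc_pos (unit_space H)) :
    rel f h -> rel f h' -> type_equiv h h'.
  move=> /slice_equiv_sym fh /slice_equiv_sym fh'.
  exact: (type_equiv_div eH hG PR fh fh').
have [t tP] := choice totG.
(* On classes, phi is computed from the chosen representative; phiE says that
   any related pair of functions computes it. *)
pose phi (x : type_semigroup G) : type_semigroup H := type_class (t (repr x)).
have phiE (f : Cc_pos (unit_space G)) (h : Cc_pos (unit_space H)) :
    rel f h -> phi (type_class f) = type_class h.
  move=> fh; apply/type_class_eq; apply: divH fh.
  apply: (type_equiv_act eG PL _ (tP _)).
  by apply/type_class_eq; rewrite type_class_repr.
have phi_additive : nmod_morphism phi.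
  split=> [|x y].
    by apply: phiE; exists [::]; split=> // u; rewrite big_nil.
  rewrite -[x]type_class_repr -[y]type_class_repr -type_classD.
  rewrite (phiE _ _ (tP (repr x))) (phiE _ _ (tP (repr y))) -type_classD.
  by apply: phiE; exact: slice_equivD (tP (repr x)) (tP (repr y)).
have phi_inj : injective phi.
  move=> x y /type_class_eq xy; rewrite -[x]type_class_repr -[y]type_class_repr.
  apply/type_class_eq; apply: (type_equiv_div eG hH PL _ (tP (repr y))).
  exact: actH xy (tP (repr x)).
have [psi psiK] : exists psi, cancel psi phi.
  suff /choice[psi psiK] : forall y, exists x, phi x = y by exists psi.
  move=> y; have [f fy] := totH (repr y); exists (type_class f).
  by rewrite (phiE _ _ fy) type_class_repr.
pose phi_mix := GRing.isNmodMorphism.Build _ _ phi phi_additive.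
pose phi_add : {additive type_semigroup G -> type_semigroup H} :=
  HB.pack phi phi_mix.
exists phi_add; exists psi => // x; apply: phi_inj; exact: psiK.
Qed.
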